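(* Let $\Phi_\Theta : X \to Z$ be a neural network of depth $L\ge 1$ of the form described in the context, with $\Phi_\Theta=(\Phi_{\Theta,1},\dots,\Phi_{\Theta,D})^T$. Suppose that: (C1) for every $k=1,\dots,L$, every component $\sigma^k_d$ of $\sigma^k$ is continuous, convex and monotone nondecreasing; (C2) the matrix $W^k$ has nonnegative entries for every $k=2,\dots,L$, and the matrix $A^{k,j_k}$ has nonnegative entries for every $k$ such that $j_k\ge 2$. Then $\Phi_\Theta$ is continuous and component-wise convex, i.e. for every $d=1,\dots,D$, every $\boldsymbol{x},\boldsymbol{\omega}\in X$ and every $t\in[0,1]$, $$\Phi_{\Theta,d}(t\boldsymbol{x}+(1-t)\boldsymbol{\omega})\le t\,\Phi_{\Theta,d}(\boldsymbol{x})+(1-t)\,\Phi_{\Theta,d}(\boldsymbol{\omega}).$$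
   Context: $X=(\mathbb{R}^N,\|\cdot\|_X)$ and $Z=(\mathbb{R}^D,\|\cdot\|_Z)$ are finite-dimensional normed spaces. For vectors of the same dimension, $\boldsymbol{x}\le\hat{\boldsymbol{x}}$ means $x_i\le\hat x_i$ for all $i$. A function $\sigma:\mathbb{R}^m\to\mathbb{R}$ is monotone nondecreasing if $\boldsymbol{x}\le\hat{\boldsymbol{x}}$ implies $\sigma(\boldsymbol{x})\le\sigma(\hat{\boldsymbol{x}})$. For a map with vector values, $\sigma_d$ denotes its $d$-th component. The concatenation of vectors is $C(\boldsymbol{z},\boldsymbol{x})=(z_1,\dots,z_D,x_1,\dots,x_N)^T$. Neural network of depth $L$: Fix finite-dimensional normed spaces $Z^1=X$, $Z^k=(\mathbb{R}^{D_k},\|\cdot\|_{Z_k})$ for $k=2,\dots,L+1$, with $Z^{L+1}=Z$. For $k=1,\dots,L$ fix a vector $\boldsymbol{b}^k$, matrices $W^k$ and $A^{k,j_k}$ with an index $j_k\in\{1,\dots,k\}$ (the matrix $A^{k,j_k}$ may be zero), and a possibly nonlinear map $\sigma^k:\mathbb{R}^{m_k}\to\mathbb{R}^{D_{k+1}}$, all of compatible dimensions. The parameters are $\Theta=\{\boldsymbol{b}^k;A^{k,j_k};W^k\}_{k=1}^L$. The network $\Phi_\Theta:X\to Z$ is defined by $\boldsymbol{z}^1=\boldsymbol{x}$, and for $k=1,\dots,L$, $$\boldsymbol{z}^{k+1}=\sigma^k\big(\hat{\boldsymbol{b}}^k+W^k\hat{\boldsymbol{z}}^k\big)\in Z^{k+1},\qquad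 \hat{\boldsymbol{b}}^k=\boldsymbol{b}^k+A^{k,j_k}\boldsymbol{z}^{j_k},$$ where for each $k$, either $\hat{\boldsymbol{z}}^k=\boldsymbol{z}^k$, or $\hat{\boldsymbol{z}}^k=C(\boldsymbol{z}^{i_k},\boldsymbol{z}^k)$ for a fixed index $i_k\in\{1,\dots,k\}$; finally $\Phi_\Theta(\boldsymbol{x})=\boldsymbol{z}^{L+1}$. *)

(* Defs.v *)
From HB Require Import structures.
From mathcomp Require Import all_boot all_order all_algebra.
From mathcomp Require Import all_classical all_reals all_analysis.

Set Implicit Arguments.
Unset Strict Implicit.
Unset Printing Implicit Defensive.

Import Order.TTheory GRing.Theory Num.Theory.
Import numFieldNormedType.Exports.

Local Open Scope ring_scope.

Record vnorm (R : realType) (n : nat) := VNorm {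
  vnorm_fun :> 'cV[R]_n -> R;
  vnormD : forall x y, vnorm_fun (x + y) <= vnorm_fun x + vnorm_fun y;
  vnormZ : forall (a : R) x, vnorm_fun (a *: x) = `|a| * vnorm_fun x;
  vnorm0_eq0 : forall x, vnorm_fun x = 0 -> x = 0
}.

(* The space (R^n, nu). The alias carries the norm nu and the topology it
   induces, instead of the max norm that the library puts on 'cV[R]_n. *)
Definition normed_cV (R : realType) (n : nat) (nu : vnorm R n) : Type :=
  'cV[R]_n.

HB.instance Definition _ (R : realType) (n : nat) (nu : vnorm R n) :=
  GRing.Lmodule.copy (normed_cV nu) 'cV[R]_n.

HB.instance Definition _ (R : realType) (n : nat) (nu : vnorm R n) :=
  Lmodule_isNormed.Build R (normed_cV nu)
    (@vnormD R n nu) (@vnormZ R n nu) (@vnorm0_eq0 R n nu).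

Definition lev (R : realType) (n : nat) (x y : 'cV[R]_n) : Prop :=
  forall i, x i ord0 <= y i ord0.

Definition monotone_nondecreasing (R : realType) (n : nat)
    (f : 'cV[R]_n -> R) : Prop :=
  forall x y, lev x y -> f x <= f y.

(* Layers are numbered as z^1, ..., z^(L+1) and maps as sigma^1, ..., sigma^L;
   the values of the fields at indices outside these ranges are never used.
   [skip k] is [Some i] when \hat z^k = C(z^i, z^k), and [None] when
   \hat z^k = z^k. *)
Record architecture (R : realType) := Architecture {
  depth : nat;
  width : nat -> nat;
  nrm : forall k, vnorm R (width k);
  prewidth : nat -> nat;
  act : forall k, 'cV[R]_(prewidth k) -> 'cV[R]_(width k.+1);
  resid : nat -> nat;
  skip : nat -> option nat;
  resid_range : forall k, (1 <= k <= depth)%N -> (1 <= resid k <= k)%N;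
  skip_range : forall k i, (1 <= k <= depth)%N -> skip k = Some i ->
    (1 <= i <= k)%N
}.

Section Network.
Variables (R : realType) (a : architecture R).

Definition cat_width (o : option nat) (k : nat) : nat :=
  if o is Some i then (width a i + width a k)%N else width a k.

Record parameters := NetworkParameters {
  bias : forall k, 'cV[R]_(prewidth a k);
  resmx : forall k, 'M[R]_(prewidth a k, width a (resid a k));
  weight : forall k, 'M[R]_(prewidth a k, cat_width (skip a k) k)
}.

Definition zhat (z : forall i, 'cV[R]_(width a i)) (o : option nat) (k : nat) :
    'cV[R]_(cat_width o k) :=
  match o return 'cV[R]_(cat_width o k) with
  | Some i => col_mx (z i) (z k)
  | None => z k
  end.

Variable Theta : parameters.

Definition bhat (z : forall i, 'cV[R]_(width a i)) (k : nat) :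
    'cV[R]_(prewidth a k) :=
  bias Theta k + resmx Theta k *m z (resid a k).

Definition layer (z : forall i, 'cV[R]_(width a i)) (k : nat) :
    'cV[R]_(width a k.+1) :=
  act (bhat z k + weight Theta k *m zhat z (skip a k) k).

(* [states x n] is the family z in which z^1, ..., z^(n+1) have been computed
   from the input x; its other members are 0. *)
Fixpoint states (x : 'cV[R]_(width a 1)) (n : nat) :
    forall i, 'cV[R]_(width a i) :=
  match n with
  | 0 => @eqtype.dfwith nat (fun i => 'cV[R]_(width a i)) (fun=> 0) 1 x
  | n'.+1 => @eqtype.dfwith nat (fun i => 'cV[R]_(width a i))
               (states x n') n'.+2 (layer (states x n') n'.+1)
  end.

Definition network (x : 'cV[R]_(width a 1)) : 'cV[R]_(width a (depth a).+1) :=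
  states x (depth a) (depth a).+1.

Lemma states_stable x m n i :
  (i <= m.+1)%N -> (m <= n)%N -> states x n i = states x m i.
Proof.
move=> im; elim: n => [|n IHn]; first by rewrite leqn0 => /eqP ->.
rewrite leq_eqVlt => /predU1P[-> //|mn] /=.
rewrite eqtype.dfwith_out ?IHn //.
by rewrite gtn_eqF // ltnS (leq_trans im).
Qed.

Lemma states1 x n : states x n 1 = x.
Proof. by rewrite (@states_stable x 0) //= eqtype.dfwith_in. Qed.

Lemma statesS x k : (1 <= k <= depth a)%N ->
  states x (depth a) k.+1 = layer (states x (depth a)) k.
Proof.
move=> /[dup] hk /andP[]; case: k hk => // k hk _ kL.
rewrite (@states_stable x k.+1) //= eqtype.dfwith_in /layer /bhat.
have [/andP[_ jk] E] :
    (1 <= resid a k.+1 <= k.+1)%N /\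
    forall i, (i <= k.+1)%N -> states x (depth a) i = states x k i.
  by split=> [|i ik]; [exact: resid_range | rewrite (@states_stable x k) // ltnW].
rewrite (E _ jk); congr (act (_ + _ *m _)).
move: (weight Theta k.+1) => _.
have := @skip_range _ a k.+1; case: (skip a k.+1) => [i|] hi /=; last by rewrite E.
by have /andP[_ ik] := hi i hk erefl; rewrite !E.
Qed.

End Network.

(* Main.v *)
(* By induction on k, each state z^k is continuous and component-wise convex as
   a function of the input: z^1 = x is linear, so the signs of W^1 and of the
   A^{k,1} are irrelevant; elsewhere nonnegative matrices preserve component-wise
   convex maps, and so does composition with a convex nondecreasing map. The
   norms of X and Z play a role only for continuity, where they are equivalent
   to the max norm. *)
Require Import Defs.
From mathcomp Require Import all_boot all_order all_algebra.
From mathcomp Require Import all_classical all_reals all_analysis ring.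
Import Order.TTheory GRing.Theory Num.Theory.
Import numFieldNormedType.Exports.
Local Open Scope ring_scope.

(** * Continuity of matrix-valued maps *)

Lemma continuous_mx (R : numFieldType) (T : topologicalType) (m n : nat)
    (f : T -> 'M[R]_(m, n)) :
  (forall i j, continuous (fun x => f x i j)) -> continuous f.
Proof.
move=> cf x A [P xP PA].
apply: (@filterS _ (nbhs x) _ _ _ (fun y => PA (f y))).
(* There are finitely many entries, so the entrywise neighbourhoods intersect in a neighbourhood. *)
apply: filter_forall => i; apply: filter_forall => j.
exact: cf (xP i j).
Qed.

Lemma continuous_coord (R : numFieldType) (T : topologicalType) (m n : nat)
    (f : T -> 'M[R]_(m, n)) i j :
  continuous f -> continuous (fun x => f x i j).
Proof.
by move=> cf x; exact: (continuous_comp (cf x) (@coord_continuous R m n i j _)).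
Qed.

Lemma continuous_col_mx (R : numFieldType) (T : topologicalType) (m1 m2 n : nat)
    (f : T -> 'M[R]_(m1, n)) (g : T -> 'M[R]_(m2, n)) :
  continuous f -> continuous g -> continuous (fun x => col_mx (f x) (g x)).
Proof.
move=> cf cg; apply: continuous_mx => i j; case: (split_ordP i) => k ->.
  by under eq_fun do rewrite col_mxEu; exact: continuous_coord.
by under eq_fun do rewrite col_mxEd; exact: continuous_coord.
Qed.

Lemma continuous_mulmx (R : numFieldType) (T : topologicalType) (m n p : nat)
    (A : 'M[R]_(m, n)) (f : T -> 'M[R]_(n, p)) :
  continuous f -> continuous (fun x => A *m f x).
Proof.
move=> cf; apply: continuous_mx => i j.
under eq_fun do rewrite mxE.
move=> x /=.
apply: cvg_big => [|k _]; first exact: add_continuous.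
apply: cvgM; first exact: cvg_cst.
exact: (continuous_coord _ _ _ _ _ k j cf).
Qed.

(** * Equivalence of norms on R^n *)

Lemma normed_cV_normE (R : realType) (n : nat) (nu : vnorm R n)
    (x : normed_cV nu) : `|x| = nu x.
Proof. by []. Qed.

(** Expand [x] in the standard basis and apply the triangle inequality. *)
Lemma vnorm_le_mx_norm (R : realType) (n : nat) (nu : vnorm R n) :
  exists2 C : R, 0 < C & forall x : 'cV[R]_n, nu x <= C * `|x|.
Proof.
pose e i : normed_cV nu := delta_mx i ord0.
(* The summand 1 keeps the constant positive when [n = 0]. *)
exists (1 + \sum_i `|e i|) => [|x].
  by rewrite ltr_pwDl// sumr_ge0.
have -> : nu x = `|\sum_i x i ord0 *: e i|.
  rewrite normed_cV_normE; congr (nu _).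
  rewrite {1}[x]matrix_sum_delta; apply: eq_bigr => i _.
  by rewrite big_ord1 ord1.
apply: le_trans (ler_norm_sum _ _ _) _.
rewrite mulrDl mul1r mulr_suml ler_wpDl//; apply: ler_sum => i _.
rewrite normrZ mulrC ler_wpM2l//.
rewrite [leRHS]/Num.norm/= mx_normrE.
exact: (le_bigmax _ (fun ij => `|x ij.1 ij.2|) (i, ord0)).
Qed.

(** By the reverse triangle inequality and the previous bound, [nu] is Lipschitz for the max
    norm. *)
Lemma continuous_vnorm (R : realType) (n : nat) (nu : vnorm R n) :
  continuous (nu : 'cV[R]_n -> R).
Proof.
have [C C0 nuC] := vnorm_le_mx_norm _ _ nu.
move=> x; apply/(@cvgrPdist_lt _ R^o _ (nbhs x)) => e e0.
have eC : 0 < e / C by rewrite divr_gt0.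
near=> y.
apply: le_lt_trans (ler_dist_dist (x : normed_cV nu) y) _.
rewrite normed_cV_normE (le_lt_trans (nuC _))// mulrC -ltr_pdivlMr//.
Unshelve. all: by end_near. Qed.

(* The max-norm unit sphere is compact, so nu attains a minimum on it, which is
   positive. Row vectors appear because the library's Heine-Borel theorem is
   stated for them. *)
Lemma mx_norm_le_vnorm (R : realType) (n : nat) (nu : vnorm R n) :
  exists2 c : R, 0 < c & forall x : 'cV[R]_n, c * `|x| <= nu x.
Proof.
pose S : set 'rV[R]_n := [set v : 'rV[R]_n | `|(v^T : 'cV[R]_n)| = 1]%classic.
have ctr : continuous (fun v : 'rV[R]_n => v^T : 'cV[R]_n).
  apply: continuous_mx => i j; under eq_fun do rewrite mxE.
  exact: coord_continuous.
have ctrN : continuous (fun v : 'rV[R]_n => `|(v^T : 'cV[R]_n)|).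
  by move=> v; apply: (continuous_comp (ctr v)); exact: norm_continuous.
(* If the sphere is empty ([n = 0]), every [x] is 0, since a nonzero [x] could be normalised to a
   point of it. *)
have [S0|/set0P S0] := eqVneq S set0.
  exists 1 => // x; suff -> : x = 0.
    by rewrite normr0 mulr0 (normr_ge0 (0 : normed_cV nu)).
  apply/eqP/negP => /negP x0; have : S (`|x|^-1 *: x^T).
    by rewrite /S/= linearZ/= trmxK normrZ normfV normr_id mulVf ?normr_eq0.
  by rewrite S0.
have cS : compact S.
  apply: bounded_closed_compact.
    exists 1; split=> // M M1 v Sv /=; rewrite (le_trans _ (ltW M1))// -Sv.
    rewrite /Num.norm/= !mx_normrE; apply/bigmax_leP; split.
      by apply/bigmax_geP; left.
    move=> [i j] _ /=; apply: le_trans (le_bigmax _ _ (j, i)).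
    by rewrite /= mxE.
  rewrite (_ : S = (fun v : 'rV[R]_n => `|(v^T : 'cV[R]_n)|) @^-1` [set 1])%classic //.
  apply: closed_comp; [by move=> v _; exact: ctrN|exact: closed_eq].
have [|v] := @compact_EVT_min _ R (fun v => nu v^T) S S0 cS.
  apply: continuous_subspaceT => v.
  by apply: (continuous_comp (ctr v)); exact: continuous_vnorm.
rewrite inE => Sv vmin; exists (nu v^T).
  rewrite lt_neqAle (normr_ge0 (v^T : normed_cV nu)) andbT eq_sym.
  apply/eqP => /(@vnorm0_eq0 _ _ nu) v0.
  by move: Sv; rewrite /S/= v0 normr0 => /eqP; rewrite eq_sym oner_eq0.
move=> x; have [->|x0] := eqVneq x 0.
  by rewrite normr0 mulr0 (normr_ge0 (0 : normed_cV nu)).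
have nx : 0 < `|x| by rewrite normr_gt0.
(* By homogeneity, the bound on the sphere extends to every nonzero [x]. *)
have := vmin (`|x|^-1 *: x^T); rewrite linearZ/= trmxK vnormZ.
rewrite normfV normr_id -ler_pdivrMl ?invr_gt0// invrK mulrC; apply.
by rewrite inE /S/= linearZ/= trmxK normrZ normfV normr_id mulVf ?normr_eq0.
Qed.

Lemma continuous_normed_cV (R : realType) (m n : nat) (mu : vnorm R m)
    (nu : vnorm R n) (f : 'cV[R]_m -> 'cV[R]_n) :
  continuous f -> continuous (f : normed_cV mu -> normed_cV nu).
Proof.
have [c c0 muc] := mx_norm_le_vnorm _ _ mu.
have [C C0 nuC] := vnorm_le_mx_norm _ _ nu.
move=> cf x.
apply/(@cvgrPdist_lt _ (normed_cV nu) _ (nbhs (x : normed_cV mu))) => e e0.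
have eC : 0 < e / C by rewrite divr_gt0.
have /(@cvgrPdist_lt _ 'cV[R]_n _ (nbhs (x : 'cV[R]_m))) := cf x.
move=> /(_ _ eC)/nbhs_normP[d d0 fd].
(* The [mu]-ball of radius [c * d] lies in the max-norm ball of radius [d]. *)
apply/(@nbhs_normP _ (normed_cV mu)); exists (c * d); first exact: mulr_gt0.
move=> y /= xy; rewrite normed_cV_normE (le_lt_trans (nuC _))//.
rewrite mulrC -ltr_pdivlMr//; apply: fd => /=.
by rewrite -(ltr_pM2l c0) (le_lt_trans (muc _)).
Qed.

(** * Component-wise order and convexity *)

Lemma lev_mulmx (R : realType) (m n : nat) (A : 'M[R]_(m, n))
    (x y : 'cV[R]_n) :
  (forall i j, 0 <= A i j) -> lev x y -> lev (A *m x) (A *m y).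
Proof. by move=> A0 xy i; rewrite !mxE ler_sum// => j _; rewrite ler_wpM2l. Qed.

Lemma levD (R : realType) (n : nat) (x y x' y' : 'cV[R]_n) :
  lev x y -> lev x' y' -> lev (x + x') (y + y').
Proof. by move=> xy xy' i; rewrite !mxE lerD. Qed.

Lemma lev_col_mx (R : realType) (m n : nat) (x y : 'cV[R]_m) (x' y' : 'cV[R]_n) :
  lev x y -> lev x' y' -> lev (col_mx x x') (col_mx y y').
Proof.
by move=> xy xy' i; rewrite !mxE; case: (fintype.split i).
Qed.

(** Replaces the bundled element of [0,1] in [convex_function] by a real [t] with explicit
    bounds. *)
Lemma convex_functionP (R : realType) (n : nat) (f : 'cV[R]_n -> R) :
  convex_function [set: 'cV[R]_n] f ->
  forall (x y : 'cV[R]_n) (t : R), 0 <= t <= 1 ->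
    f (t *: x + (1 - t) *: y) <= t * f x + (1 - t) * f y.
Proof.
move=> cf x y t t01.
have /andP[t0 t1] := t01.
exact: (cf (Itv01 t0 t1) x y (in_setT _) (in_setT _)).
Qed.

(** * Continuity and convexity of the states *)

Section Network.
Context {R : realType} {a : architecture R} (Theta : parameters a).
Local Notation L := (depth a).
Local Notation z x := (states Theta x L).

Hypothesis C1 : forall k, (1 <= k <= L)%N -> forall d : 'I_(width a k.+1),
  let sigma_kd := fun y : 'cV[R]_(prewidth a k) => act y d ord0 : R in
  [/\ continuous sigma_kd,
      convex_function [set: 'cV[R]_(prewidth a k)] sigma_kd
    & monotone_nondecreasing sigma_kd].

(** Serves the first layer: [W^1] may have entries of any sign, so equalities are carried through it
    instead of inequalities. *)
Lemma zhatD_comb (u v w : forall i, 'cV[R]_(width a i)) o k (s t : R) :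
  (forall i, o = Some i -> u i = s *: v i + t *: w i) ->
  u k = s *: v k + t *: w k ->
  zhat u o k = s *: zhat v o k + t *: zhat w o k.
Proof.
case: o => //= i /(_ i erefl) -> ->.
by rewrite !scale_col_mx add_col_mx.
Qed.

Lemma lev_zhat_comb (u v w : forall i, 'cV[R]_(width a i)) o k (s t : R) :
  (forall i, o = Some i -> lev (u i) (s *: v i + t *: w i)) ->
  lev (u k) (s *: v k + t *: w k) ->
  lev (zhat u o k) (s *: zhat v o k + t *: zhat w o k).
Proof.
case: o => //= i /(_ i erefl) ui uk.
by rewrite !scale_col_mx add_col_mx; exact: lev_col_mx.
Qed.

(** The induction is strong because [resid] and [skip] may refer to any earlier state. Topologies
    here are those of the max norms. *)
Lemma continuous_states i : (1 <= i <= L.+1)%N ->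
  continuous (fun x => z x i).
Proof.
elim/ltn_ind: i => -[//|[_ _|k IH /= kL]].
  by under eq_fun do rewrite states1; exact: id.
under eq_fun do rewrite statesS//.
have pre : continuous (fun x => bhat Theta (z x) k.+1
    + weight Theta k.+1 *m zhat (z x) (skip a k.+1) k.+1).
  have cz i : (1 <= i <= k.+1)%N -> continuous (fun x => z x i).
    by move=> /andP[i1 ik]; apply: IH; rewrite ?i1 ?(leq_trans ik (ltnW kL)).
  move=> x; apply: (@cvgD _ 'cV[R]_(prewidth a k.+1) _ (nbhs x)).
    apply: (@cvgD _ 'cV[R]_(prewidth a k.+1) _ (nbhs x)); first exact: cvg_cst.
    by apply: continuous_mulmx; apply: cz; exact: resid_range.
  apply: continuous_mulmx; have := @skip_range _ a k.+1.
  case: (skip a k.+1) => [i|_] /=; last by apply: cz; rewrite ?leqnn.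
  move=> /(_ i kL erefl) ik.
  by apply: continuous_col_mx; apply: cz; rewrite ?leqnn.
apply: continuous_mx => d j; rewrite ord1 => x.
have [cs _ _] := C1 k.+1 kL d.
exact: (continuous_comp (pre x) (cs _)).
Qed.

Hypothesis C2W : forall k, (2 <= k <= L)%N ->
  forall i j, 0 <= weight Theta k i j.
Hypothesis C2A : forall k, (1 <= k <= L)%N -> (2 <= resid a k)%N ->
  forall i j, 0 <= resmx Theta k i j.

Lemma convex_states (x w : 'cV[R]_(width a 1)) (t : R) i :
  0 <= t <= 1 -> (1 <= i <= L.+1)%N ->
  lev (z (t *: x + (1 - t) *: w) i) (t *: z x i + (1 - t) *: z w i).
Proof.
move=> t01; set y := t *: x + _.
(* The state of index 1 is the input itself, so convexity holds there with equality. *)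
have z1 j : (j <= 1)%N -> (1 <= j)%N -> z y j = t *: z x j + (1 - t) *: z w j.
  by case: j => [|[|]]// _ _; rewrite !states1.
elim/ltn_ind: i => -[//|[_ _|k IH /= kL]].
  by move=> d; rewrite z1.
have cz i : (1 <= i <= k.+1)%N ->
    lev (z y i) (t *: z x i + (1 - t) *: z w i).
  by move=> /andP[i1 ik]; apply: IH; rewrite ?i1 ?(leq_trans ik (ltnW kL)).
rewrite !statesS// => d; have [_ /convex_functionP cs ms] := C1 k.+1 kL d.
rewrite [leRHS]mxE [X in X + _]mxE [X in _ + X]mxE.
(* Convexity of the activation, then its monotonicity, reduce the claim to comparing
   pre-activations. *)
apply: le_trans (cs _ _ _ t01); apply: ms.
rewrite /bhat; set b := bias _ _; set A := resmx _ _; set W := weight _ _.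
(* As [t + (1 - t) = 1], the bias is its own convex combination. *)
have -> (u1 u2 v1 v2 : 'cV[R]_(prewidth a k.+1)) :
    t *: (b + u1 + v1) + (1 - t) *: (b + u2 + v2) =
    b + (t *: u1 + (1 - t) *: u2) + (t *: v1 + (1 - t) *: v2).
  by apply/matrixP => p q; rewrite !mxE; ring.
apply: levD; first apply: levD => //.
  have /andP[j1 jk] := @resid_range _ a k.+1 kL.
  (* For residual index 1 both sides agree by [z1]; beyond it [C2A] preserves the order. *)
  rewrite !scalemxAr -mulmxDr; have [jle|jgt] := leqP (resid a k.+1) 1.
    by rewrite z1.
  by apply: lev_mulmx; [exact: (C2A k.+1 kL jgt)|apply: cz; rewrite j1].
rewrite !scalemxAr -mulmxDr.
have sk i : skip a k.+1 = Some i -> (1 <= i <= k.+1)%N by exact: skip_range.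
(* The layer is [k.+1]: for [k = 0] a skip can only reach the input, so [zhat] respects the
   combination exactly; for [k > 0], [C2W] applies. *)
have [k0|kgt] := posnP k.
  rewrite (@zhatD_comb (z y) (z x) (z w) _ _ t (1 - t))// => [i /sk/andP[i1 ik]|].
    by rewrite z1// -k0.
  by rewrite z1 // k0.
apply: lev_mulmx; first by apply: C2W; rewrite ltnS kgt.
by apply: lev_zhat_comb => [i /sk|]; [exact: cz|apply: cz; rewrite leqnn].
Qed.

End Network.

Theorem theorem3p1 (R : realType) (a : architecture R) (Theta : parameters a)
  (L_ge1 : (1 <= depth a)%N)
  (C1 : forall k : nat, (1 <= k <= depth a)%N ->
    forall d : 'I_(width a k.+1),
      let sigma_kd := fun y : 'cV[R]_(prewidth a k) => act y d ord0 : R in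
      [/\ continuous sigma_kd,
          convex_function [set: 'cV[R]_(prewidth a k)] sigma_kd
        & monotone_nondecreasing sigma_kd])
  (C2W : forall k : nat, (2 <= k <= depth a)%N ->
    forall i j, 0 <= weight Theta k i j)
  (C2A : forall k : nat, (1 <= k <= depth a)%N -> (2 <= resid a k)%N ->
    forall i j, 0 <= resmx Theta k i j) :
  continuous (network Theta :
    normed_cV (nrm a 1) -> normed_cV (nrm a (depth a).+1)) /\
  (forall (d : 'I_(width a (depth a).+1)) (x w : 'cV[R]_(width a 1)) (t : R),
    0 <= t <= 1 ->
    network Theta (t *: x + (1 - t) *: w) d ord0 <=
      t * network Theta x d ord0 + (1 - t) * network Theta w d ord0).
Proof.
split=> [|d x w t t01].
  apply: continuous_normed_cV.
  by apply: continuous_states C1 _ _; rewrite leqnn.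
(* The output is the state of index [(depth a).+1]. *)
have := @convex_states R a Theta C1 C2W C2A x w t (depth a).+1 t01.
by rewrite leqnn => /(_ isT d); rewrite !mxE.
Qed.
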